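(* Let $(X,\rho,\mu)$ be a space of homogeneous type and let $\mathcal{D}^{\alpha}$, $\alpha\in A$ ($A$ finite), be adjacent systems of dyadic cubes on $X$. Then there exist $\epsilon,\eta>0$ (depending only on $(X,\rho,\mu)$ and the systems $\mathcal{D}^{\alpha}$) such that the following holds. Let $\mathcal{X}:=\{(x,s,t)\in X\times(0,\infty)\times(0,\infty): s\le t\}$ and let $F:\mathcal{X}\to[0,\infty]$ be a function that is monotonic in the sense that \[ s\leq s'\leq t'\leq t \implies F(x,s',t')\leq F(x,s,t) \] and subadditive in the sense that \[ s\leq s'\leq t \implies F(x,s,t)\leq F(x,s,s')+F(x,s',t). \] Suppose that for every dyadic cube $Q\in\bigcup_{\alpha}\mathcal{D}^{\alpha}$ there is a number $c_{Q}\geq 0$ such that \[ \mu\{\mathcal{N}_{Q}F > c_{Q}\} \leq \epsilon\, \mu(Q). \] Then for every $\alpha\in A$ and $k_{0}\in\mathbb{Z}$ there exists an $\eta$-sparse collection $\mathcal{S}^{\alpha,k_{0}}\subset\mathcal{D}^{\alpha}$ such that \[ \mathcal{N}F \leq \liminf_{k_{0}\to-\infty} \sum_{\alpha\in A} \sum_{Q\in\mathcal{S}^{\alpha,k_{0}}} 1_{Q}\, c_{Q} \] holds pointwise $\mu$-almost everywhere on $X$.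
   Context: Space of homogeneous type. A quasi-metric on $X$ is a symmetric function $\rho:X\times X\to[0,\infty)$ with $\rho(x,y)=0\iff x=y$ and $\rho(x,y)\le A_{0}(\rho(x,z)+\rho(z,y))$ for all $x,y,z$, for some $A_{0}<\infty$. Balls are $B(x,r)=\{y:\rho(x,y)<r\}$. (Balls need not be open, but can be made open by passing to an equivalent quasi-metric.) A space of homogeneous type is a triple $(X,\rho,\mu)$ with $\rho$ a quasi-metric and $\mu$ a doubling measure: $\mu(B(x,2r))\le A_{1}\mu(B(x,r))$ for all $x\in X$, $r>0$, for some $A_{1}<\infty$; balls have positive and finite measure. Systems of dyadic cubes. A system of dyadic sets $\mathcal{D}$ is a sequence $(\mathcal{D}_{k})_{k\in\mathbb{Z}}$ of collections of measurable subsets of $X$ such that for all $l\le k$: (i) $\mu(X\setminus\bigcup_{Q\in\mathcal{D}_{k}}Q)=0$; (ii) for $Q\in\mathcal{D}_{k}$, $Q'\in\mathcal{D}_{l}$ either $Q\subseteq Q'$ or $Q\cap Q'=\emptyset$. Elements $Q\in\mathcal{D}$ remember their generation $k(Q)$ (the same set may occur in several generations and is then counted as several different elements); the relation $Q'\subseteq Q$ between elements includes $k(Q')\ge k(Q)$, and $Q'=Q$ includes $k(Q')=k(Q)$. It is a system of dyadic cubes if for some $0<\delta<1$, $0<c_{1}\le C_{1}<\infty$, for every $k\in\mathbb{Z}$ and $Q\in\mathcal{D}_{k}$ there is $z=z(Q)\in X$ with $B(z,c_{1}\delta^{k})\subseteq Q\subseteq B(z,C_{1}\delta^{k})$. Systems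 of dyadic cubes $\mathcal{D}^{\alpha}$, $\alpha\in A$, are adjacent if there is $C_{3}<\infty$ such that for every $z\in X$, $r>0$ there exist $\alpha\in A$, $k\in\mathbb{Z}$, $Q\in\mathcal{D}^{\alpha}_{k}$ with $B(z,r)\subset Q\subset B(z,C_{3}r)$. Sparse collections. $\mathcal{S}\subset\mathcal{D}$ is $\eta$-sparse if there are pairwise disjoint measurable subsets $E(Q)\subset Q$, $Q\in\mathcal{S}$, with $\mu(E(Q))\ge\eta\,\mu(Q)$. Nontangential maximal operator. For $F:\mathcal{X}\to[0,\infty]$ and $Q\subset X$, \[ (\mathcal{N}_{Q}F)(x):=1_{Q}(x)\sup\{F(y,s,t): y\in X,\ \rho(x,y)<s<t\le \mathrm{dist}(y,X\setminus Q)\}, \] where $s,t\in(0,\infty)$, $\mathrm{dist}(y,\emptyset)=+\infty$, $\sup\emptyset=0$; and $\mathcal{N}:=\mathcal{N}_{X}$. *)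

(* Defs.v *)
From HB Require Import structures.
From mathcomp Require Import all_boot all_order all_algebra.
From mathcomp Require Import all_classical all_reals all_analysis.

Set Implicit Arguments.
Unset Strict Implicit.
Unset Printing Implicit Defensive.

Import Order.TTheory GRing.Theory Num.Theory.
Import numFieldNormedType.Exports.

Local Open Scope classical_set_scope.
Local Open Scope ring_scope.

Section homogeneous_space.
Context {R : realType} {d : measure_display} {X : measurableType d}.
Implicit Types (rho : X -> X -> R) (mu : {measure set X -> \bar R}).

Definition quasi_metric rho : Prop :=
  [/\ forall x y, 0 <= rho x y,
      forall x y, rho x y = rho y x,
      forall x y, rho x y = 0 <-> x = y
    & exists A0 : R, forall x y z, rho x y <= A0 * (rho x z + rho z y)].

Definition qball rho (x : X) (r : R) : set X := [set y | rho x y < r].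

Definition doubling rho mu : Prop :=
  exists A1 : R, forall x r, 0 < r ->
    (mu (qball rho x (2 * r)) <= A1%:E * mu (qball rho x r))%E.

(* The sigma-algebra is only required to contain the balls; balls need not be
   open, and no regularity of [mu] is assumed. *)
Definition space_of_homogeneous_type rho mu : Prop :=
  [/\ quasi_metric rho,
      forall x r, measurable (qball rho x r),
      forall x r, 0 < r -> (0 < mu (qball rho x r) < +oo)%E
    & doubling rho mu].

(* [ereal_inf set0 = +oo], so the distance to the empty set is [+oo]. *)
Definition qdist rho (y : X) (E : set X) : \bar R :=
  ereal_inf [set (rho y z)%:E | z in E].

(* [D k] is the collection of generation [k]. *)
Definition dyadic_sets mu (D : int -> set (set X)) : Prop :=
  [/\ forall k Q, D k Q -> measurable Q,
      forall k, mu.-negligible (~` \bigcup_(Q in D k) Q)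
    & forall l k : int, l <= k -> forall Q Q', D k Q -> D l Q' ->
        Q `<=` Q' \/ Q `&` Q' = set0].

Definition dyadic_cubes rho mu (D : int -> set (set X)) : Prop :=
  dyadic_sets mu D /\
  exists delta c1 C1 : R,
    [/\ 0 < delta < 1, 0 < c1, c1 <= C1
      & forall (k : int) Q, D k Q -> exists z : X,
          qball rho z (c1 * delta ^ k) `<=` Q /\
          Q `<=` qball rho z (C1 * delta ^ k)].

Definition adjacent_systems (A : Type) rho (D : A -> int -> set (set X)) : Prop :=
  exists C3 : R, forall (z : X) (r : R), 0 < r ->
    exists (a : A) (k : int) (Q : set X),
      [/\ D a k Q, qball rho z r `<=` Q & Q `<=` qball rho z (C3 * r)].

(* Cubes remember their generation: an element of a system is a pair
   [(k(Q), Q)], so a set lying in several generations gives several elements. *)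
Definition elements (D : int -> set (set X)) : set (int * set X) :=
  [set Q | D Q.1 Q.2].

Definition sparse mu (eta : R) (S : set (int * set X)) : Prop :=
  exists E : int * set X -> set X,
    [/\ forall Q, S Q -> measurable (E Q),
        forall Q, S Q -> E Q `<=` Q.2,
        forall Q, S Q -> (eta%:E * mu Q.2 <= mu (E Q))%E
      & trivIset S E].

(* Functions on the domain 0 < s <= t are represented by functions on all of
   X * R * R; their values outside this domain are never used. *)
Definition nonneg_fun (F : X -> R -> R -> \bar R) : Prop :=
  forall x s t, 0 < s -> s <= t -> (0 <= F x s t)%E.

Definition monotonic_fun (F : X -> R -> R -> \bar R) : Prop :=
  forall x s s' t' t, 0 < s -> s <= s' -> s' <= t' -> t' <= t ->
    (F x s' t' <= F x s t)%E.

Definition subadditive_fun (F : X -> R -> R -> \bar R) : Prop :=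
  forall x s s' t, 0 < s -> s <= s' -> s' <= t ->
    (F x s t <= F x s s' + F x s' t)%E.

(* Adjoining 0 implements the convention sup(empty) = 0 for suprema in
   [0, +oo], since [ereal_sup set0 = -oo]. *)
Definition nontangential_max rho (Q : set X) (F : X -> R -> R -> \bar R)
    (x : X) : \bar R :=
  ((\1_Q x)%:E * ereal_sup
    (0%:E |` [set v | exists (y : X) (s t : R),
       [/\ (0 < s)%R, (rho x y < s)%R, (s < t)%R, t%:E <= qdist rho y (~` Q)
         & v = F y s t]]))%E.

End homogeneous_space.

(* The lower limit of [u k] as k -> -oo. *)
Definition liminf_ninfty (R : realType) (u : int -> \bar R) : \bar R :=
  ereal_sup [set ereal_inf [set u k | k in [set k : int | k <= K]]
            | K in [set: int]].

(* Main.v *)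
(* To dominate F(y,s,t) with B(y,t) inside a cube Q, let Om(Q) be a measurable
   superset, of measure at most e mu(Q), of the set where N_Q F > c_Q.  If B(y,s)
   is not inside Om(Q), then F(y,s,t) <= c_Q.  Otherwise double s up to the last
   s' with B(y,s') inside Om(Q): subadditivity gives
   F(y,s,t) <= F(y,s,2s') + c_Q, and an adjacent cube P containing B(y,2s'), of
   measure comparable to that of B(y,s'), is "stopped by Q", i.e. Om(Q) fills a
   fixed proportion of P.  For small e such a P is strictly smaller than Q, so the
   argument can be repeated with P in place of Q until the cubes are smaller than
   s.

   P need not lie inside Q, so taking all (or all maximal) stopped cubes of
   selected cubes could produce too many cubes.  Instead, P is selected for Q only
   if no selected cube of the same system contains P and is smaller than Q; if
   there is one, it serves just as well as P.  Then the cubes selected strictly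
   below a given Q0 arise from selected Q not larger than Q0 and near Q0, and
   sparseness follows by induction on scales.  The domination holds at every
   point, with the selection started from a single top cube containing
   B(x0, |k0| + 1). *)

Require Import Defs.
From HB Require Import structures.
From mathcomp Require Import all_boot all_order all_algebra.
From mathcomp Require Import all_classical all_reals all_analysis.
From mathcomp Require Import lra zify.

Import Order.TTheory GRing.Theory Num.Theory.
Import numFieldNormedType.Exports.

Local Open Scope classical_set_scope.
Local Open Scope ring_scope.

Set Implicit Arguments.
Unset Strict Implicit.
Unset Printing Implicit Defensive.

(** * Enumeration and recursion *)

Lemma countable_enum (I : Type) (S : set I) (i0 : I) : countable S -> S i0 ->
  exists e : nat -> I, (forall n, S (e n)) /\ forall i, S i -> exists n, e n = i.
Proof.
move=> /countable_injP[f finj] Si0.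
have /choice[e eP] n : exists j, S j /\ forall i, S i -> f i = n -> j = i.
  have [[i [Si <-]]|noi] := pselect (exists i, S i /\ f i = n).
    exists i; split => // j Sj fji; apply: finj; rewrite ?inE//.
  by exists i0; split => // i Si fin; case: noi; exists i.
exists e; split=> [n|i Si]; first by have [] := eP n.
by exists (f i); have [_ /(_ i Si erefl)] := eP (f i).
Qed.

(** Iterating [Phi] from the empty predicate settles membership of [x] after [m x + 1] steps,
    because only points of smaller [m] matter; no monotonicity of [Phi] is involved. *)
Lemma strong_recursion (T : Type) (m : T -> nat)
    (Phi : (T -> Prop) -> T -> Prop) :
  (forall S S' x, (forall y, (m y < m x)%N -> S y <-> S' y) ->
     Phi S x <-> Phi S' x) ->
  exists S, forall x, S x <-> Phi S x.
Proof.
move=> PhiE.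
pose Sn := fix F n : T -> Prop := if n is n'.+1 then Phi (F n') else fun=> False.
have SnE n k x : (m x < n)%N -> (m x < k)%N -> Sn n x <-> Sn k x.
  elim: n k x => // n IH [//|k] x xn xk; apply: PhiE => y yx.
  by apply: IH; exact: leq_trans yx _.
exists (fun x => Sn (m x).+1 x) => x.
have -> : Sn (m x).+1 x <-> Phi (Sn (m x)) x by [].
by apply: PhiE => y yx; exact: SnE.
Qed.

(** * Measures of countable unions and of disjoint families *)

Section measure_lemmas.
Context {R : realType} {d : measure_display} {X : measurableType d}.
Variable mu : {measure set X -> \bar R}.

Lemma measure_subset (A B : set X) : measurable A -> measurable B ->
  A `<=` B -> (mu A <= mu B)%E.
Proof. by move=> mA mB AB; apply: le_measure => //; rewrite inE. Qed.

Lemma sum_measure_disjoint (I : eqType) (F : I -> set X) (J : seq I) (V : set X) :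
  uniq J -> measurable V ->
  (forall i, i \in J -> measurable (F i) /\ F i `<=` V) ->
  (forall i j, i \in J -> j \in J -> i != j -> F i `&` F j = set0) ->
  (\sum_(i <- J) mu (F i) <= mu V)%E.
Proof.
elim: J V => [|i J IH] V /=; first by rewrite big_nil.
move=> /andP[iJ uJ] mV FV Fdisj.
have [mFi FiV] := FV i (mem_head _ _).
have -> : mu V = (mu (F i) + mu (V `\` F i))%E.
  by rewrite (measureDI mu mV mFi) addeC setIidr.
rewrite big_cons; apply: leeD2l; apply: IH => //.
- exact: measurableD.
- move=> j jJ; have [|mFj FjV] := FV j; first by rewrite in_cons jJ orbT.
  split=> // x Fjx; split; first exact: FjV.
  move=> Fix; have : (F i `&` F j) x by [].
  rewrite Fdisj ?mem_head ?in_cons ?jJ ?orbT//.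
  by apply: contraNneq iJ => ->.
- by move=> j k jJ kJ; apply: Fdisj; rewrite in_cons ?jJ ?kJ orbT.
Qed.

Lemma measure_seq_cover (I : eqType) (F : I -> set X) (J : seq I) :
  (forall i, i \in J -> measurable (F i)) ->
  measurable (\bigcup_(i in [set` J]) F i) /\
  (mu (\bigcup_(i in [set` J]) F i) <= \sum_(i <- J) mu (F i))%E.
Proof.
elim: J => [|i J IH] mF.
  rewrite (_ : [set` [::]] = set0); last by rewrite predeqE => x; split.
  by rewrite bigcup_set0 measure0 big_nil.
have [|mU leU] := IH; first by move=> j jJ; apply: mF; rewrite in_cons jJ orbT.
have mFi := mF i (mem_head _ _).
rewrite (_ : \bigcup_(_ in _) _ = F i `|` \bigcup_(j in [set` J]) F j); last first.
  rewrite predeqE => x; split.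
    by move=> [j /= + Fjx]; rewrite in_cons => /orP[/eqP <-|jJ]; [left|right; exists j].
  move=> [Fix|[j /= jJ Fjx]]; first by exists i => //=; rewrite mem_head.
  by exists j => //=; rewrite in_cons jJ orbT.
split; first exact: measurableU.
rewrite big_cons; apply: (le_trans (measureU2 mu mFi mU)).
exact: leeD2l.
Qed.

(** Along an enumeration of [S] the finite unions increase to the whole union, so continuity from
    below passes the bound to the limit. *)
Lemma measure_countable_union (I : eqType) (F : I -> set X) (S : set I)
    (C : \bar R) : (0 <= C)%E ->
  countable S -> (forall i, S i -> measurable (F i)) ->
  (forall J : seq I, (forall i, i \in J -> S i) ->
    (mu (\bigcup_(i in [set` J]) F i) <= C)%E) ->
  measurable (\bigcup_(i in S) F i) /\ (mu (\bigcup_(i in S) F i) <= C)%E.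
Proof.
move=> C0 cS mF leC.
have [[i0 Si0]|S0] := pselect (exists i, S i); last first.
  rewrite (_ : S = set0); last by rewrite -subset0 => i Si; apply: S0; exists i.
  by rewrite bigcup_set0 measure0.
have [e [Se eS]] := countable_enum cS Si0.
pose J n := undup [seq e k | k <- iota 0 n].
pose U n := \bigcup_(i in [set` J n]) F i.
have JS n i : i \in J n -> S i by rewrite mem_undup => /mapP[k _ ->].
have memJ k n : (k < n)%N -> e k \in J n.
  by move=> kn; rewrite mem_undup; apply: map_f; rewrite mem_iota.
have [mU leU] : (forall n, measurable (U n)) /\ (forall n, (mu (U n) <= C)%E).
  suff H n : measurable (U n) /\ (mu (U n) <= C)%E.
    by split=> n; have [] := H n.
  have mFJ : forall i, i \in J n -> measurable (F i) by move=> i /JS /mF.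
  by split; [have [] := measure_seq_cover mFJ|apply: leC; exact: JS].
have -> : \bigcup_(i in S) F i = \bigcup_n U n.
  rewrite predeqE => x; split.
    move=> [i /eS[n <-] Fx]; exists n.+1 => //; exists (e n) => //.
    exact: memJ.
  by move=> [n _ [i /= /JS Si Fx]]; exists i.
have mUU : measurable (\bigcup_n U n) by exact: bigcup_measurable.
split=> //.
have Uhomo : {homo U : n m / (n <= m)%N >-> (n <= m)%O}.
  move=> n m nm; apply/subsetPset => x [i /=]; rewrite mem_undup => /mapP[k].
  rewrite mem_iota => /andP[_ kn] -> Fx; exists (e k) => //.
  by apply: memJ; exact: leq_trans kn _.
have cvgU := nondecreasing_cvg_mu (mu := mu) mU mUU Uhomo.
rewrite -(cvg_lim (@ereal_hausdorff R) cvgU).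
apply: lime_le; first by apply/cvg_ex; exists (mu (\bigcup_n U n)).
by near=> n => /=; exact: leU.
Unshelve. all: by end_near. Qed.

Lemma measure_countable_cover (I : eqType) (F : I -> set X) (S : set I)
    (C : \bar R) : (0 <= C)%E ->
  countable S -> (forall i, S i -> measurable (F i)) ->
  (forall J : seq I, uniq J -> (forall i, i \in J -> S i) ->
    (\sum_(i <- J) mu (F i) <= C)%E) ->
  measurable (\bigcup_(i in S) F i) /\ (mu (\bigcup_(i in S) F i) <= C)%E.
Proof.
move=> C0 cS mF leC; apply: measure_countable_union => // J JS.
have uJS i : i \in undup J -> S i by rewrite mem_undup; exact: JS.
rewrite (_ : [set` J] = [set` undup J]); last first.
  by rewrite predeqE => i /=; rewrite mem_undup.
have [_ /le_trans] := @measure_seq_cover _ F _ (fun i iJ => mF i (uJS i iJ)).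
by apply; apply: leC => //; exact: undup_uniq.
Qed.

(** For each [n], only finitely many disjoint subsets of [V] can have measure at least [1/(n+1)],
    and every set of positive measure occurs for some [n]. *)
Lemma countable_disjoint_family (I : choiceType) (F : I -> set X) (S : set I)
    (V : set X) : measurable V -> (mu V < +oo)%E ->
  (forall i, S i -> [/\ measurable (F i), F i `<=` V & (0 < mu (F i))%E]) ->
  (forall i j, S i -> S j -> i != j -> F i `&` F j = set0) ->
  countable S.
Proof.
move=> mV Voo SF Fdisj.
pose Sn (n : nat) := [set i | S i /\ ((n.+1%:R^-1)%:E <= mu (F i))%E].
have SE : S `<=` \bigcup_n Sn n.
  move=> i Si; have [mFi _ Fi0] := SF i Si.
  have [Fioo|Fifin] := leP +oo%E (mu (F i)).
    by exists 0%N => //; split=> //; apply: le_trans Fioo; rewrite leey.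
  have fF : mu (F i) \is a fin_num by rewrite ge0_fin_numE.
  have f0 : 0 < fine (mu (F i)) by rewrite fine_gt0// Fi0.
  exists (Num.trunc (fine (mu (F i)))^-1) => //; split=> //.
  rewrite -(fineK fF) lee_fin -[leRHS]invrK lef_pV2 ?posrE ?invr_gt0//.
  by apply/ltW; rewrite truncnS_gt.
apply: (sub_countable (subset_card_le SE)).
apply: bigcup_countable => // n _.
apply: finite_set_countable; apply: contrapT => infS.
(* With [m > (n+1) mu V], any [m] members of [Sn n] would have total measure above [mu V]. *)
pose m := (Num.trunc (fine (mu V) * n.+1%:R)).+1.
have [B BS mB] := infinite_set_fset m infS.
have fV : mu V \is a fin_num by rewrite ge0_fin_numE.
have : (\sum_(i <- finmap.enum_fset B) mu (F i) <= mu V)%E.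
  apply: sum_measure_disjoint => //.
  - by move=> i iB; have [/SF[]] := BS i iB.
  - by move=> i j iB jB; apply: Fdisj; [have [] := BS i iB|have [] := BS j jB].
apply/negP; rewrite -ltNge.
have : (\sum_(i <- finmap.enum_fset B) (n.+1%:R^-1)%:E <=
        \sum_(i <- finmap.enum_fset B) mu (F i))%E.
  rewrite big_seq [leRHS]big_seq; apply: lee_sum => i iB.
  by have [] := BS i iB.
apply: lt_le_trans.
rewrite sumEFin -(fineK fV) lte_fin big_const_seq count_predT iter_addr_0.
rewrite -[ltRHS]mulr_natl ltr_pdivlMr ?ltr0n//.
by apply: (lt_le_trans (truncnS_gt _)); rewrite ler_nat.
Qed.

End measure_lemmas.

(** * Stopping families and their sparseness *)

Section stopping.
Context {R : realType} {d : measure_display} {X : measurableType d}.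
Context {A : finType}.
Variable mu : {measure set X -> \bar R}.
Variables (D : A -> int -> set (set X)) (n : A -> int -> int).

Local Notation cube := (A * (int * set X))%type.
Implicit Types P Q top : cube.

Definition valid (Q : cube) := D Q.1 Q.2.1 Q.2.2.
Definition rank (Q : cube) := n Q.1 Q.2.1.
Definition descends (P Q : cube) := [/\ P.1 = Q.1, Q.2.1 < P.2.1 & P.2.2 `<=` Q.2.2].

(* [star P] is a ball around [P] containing all neighbours of [P] that are not
   larger than [P]; larger [rank] means smaller cube. *)
Variables (star Om : cube -> set X) (K K' eps : R).

Hypothesis n_mono : forall a k l, k < l -> n a k < n a l.
Hypothesis nested : forall a (l k : int), l <= k ->
  forall Q Q' : set X, D a k Q -> D a l Q' -> Q `<=` Q' \/ Q `&` Q' = set0.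
Hypothesis valid_measurable : forall Q, valid Q -> measurable Q.2.2.
Hypothesis valid_measure : forall Q, valid Q -> (0 < mu Q.2.2 < +oo)%E.
Hypothesis star_measurable : forall Q, valid Q -> measurable (star Q).
Hypothesis star_sub : forall P Q x, valid P -> valid Q -> rank P <= rank Q ->
  P.2.2 x -> Q.2.2 x -> Q.2.2 `<=` star P.
Hypothesis star_measure : forall Q, valid Q ->
  (mu (star Q) <= K%:E * mu Q.2.2)%E.
Hypothesis Om_measurable : forall Q, valid Q -> measurable (Om Q).
Hypothesis Om_sub : forall Q, valid Q -> Om Q `<=` Q.2.2.
Hypothesis Om_measure : forall Q, valid Q ->
  (mu (Om Q) <= eps%:E * mu Q.2.2)%E.
Hypothesis K_ge1 : 1 <= K.
Hypothesis K'_ge1 : 1 <= K'.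
Hypothesis eps_gt0 : 0 < eps.
Hypothesis eps_small : 4 * (#|A|.+1%:R) * K * K' * eps <= 1.

Definition stops Q P := valid P /\ (mu P.2.2 <= K'%:E * mu (P.2.2 `&` Om Q))%E.

Lemma descends_rank P Q : descends P Q -> rank Q < rank P.
Proof. by case=> PQ QP _; rewrite /rank PQ; exact: n_mono. Qed.

Lemma stops_meets Q P : valid Q -> stops Q P -> exists x, P.2.2 x /\ Q.2.2 x.
Proof.
move=> vQ [vP PQ]; apply: contrapT => noex.
move: PQ; rewrite (_ : _ `&` _ = set0); last first.
  rewrite -subset0 => x [Px /(Om_sub vQ) Qx]; by apply: noex; exists x.
rewrite measure0 mule0; apply/negP; rewrite -ltNge.
by have /andP[] := valid_measure vP.
Qed.

(** If [P] were at least as large as [Q], then [Q] would lie in [star P], whence [mu Q <= K mu P <=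
    K K' mu (Om Q) <= K K' eps mu Q], impossible for small [eps]. *)
Lemma stops_rank Q P : valid Q -> stops Q P -> rank Q < rank P.
Proof.
move=> vQ PQ; rewrite ltNge; apply/negP => PQr.
have [x [Px Qx]] := stops_meets vQ PQ.
have [vP lePQ] := PQ.
have QP : (mu Q.2.2 <= K%:E * mu P.2.2)%E.
  apply: le_trans (star_measure vP).
  apply: measure_subset; [exact: valid_measurable|exact: star_measurable|].
  exact: star_sub Px Qx.
have : (mu Q.2.2 <= (K * K' * eps)%:E * mu Q.2.2)%E.
  apply: (le_trans QP); rewrite !EFinM -!muleA.
  apply: lee_wpmul2l; first by rewrite lee_fin (le_trans _ K_ge1).
  apply: (le_trans lePQ).
  apply: lee_wpmul2l; first by rewrite lee_fin (le_trans _ K'_ge1).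
  apply: le_trans (Om_measure vQ); apply: measure_subset => //.
  - by apply: measurableI; [exact: valid_measurable|exact: Om_measurable].
  - exact: Om_measurable.
apply/negP; rewrite -ltNge.
have /andP[Q0 Qoo] := valid_measure vQ.
rewrite -[ltRHS]mul1e lte_pmul2r ?ge0_fin_numE// lte_fin.
have KK0 : 0 <= K * K' * eps.
  by rewrite !mulr_ge0 ?(ltW eps_gt0) ?(le_trans _ K_ge1) ?(le_trans _ K'_ge1).
have : 1 * (K * K' * eps) <= #|A|.+1%:R * (K * K' * eps).
  by apply: ler_wpM2r => //; rewrite ler1n.
move: eps_small; rewrite -!mulrA; set z := K * _; set w := _ * z.
by rewrite mul1r; lra.
Qed.

(* Membership of [P] only depends on membership of cubes of smaller rank, so the
   selection rule, although not monotone in the family, defines it by recursion. *)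
Lemma stopping_family top : valid top -> exists S : set cube,
  [/\ S top,
      forall P, S P -> valid P /\ rank top <= rank P,
      forall P, S P -> P = top \/ exists Q, [/\ S Q, stops Q P
        & forall Q0 : cube, S Q0 -> descends P Q0 -> rank Q0 <= rank Q]
    & forall P Q, S Q -> stops Q P ->
        exists Q1, [/\ S Q1, P.2.2 `<=` Q1.2.2 & rank Q < rank Q1]].
Proof.
move=> vtop.
pose below Q P := rank top <= rank Q < rank P.
(* Restricting to [below] keeps all ranks at or above [rank top], so the distance to [rank top] is a
   natural number that drops strictly from [P] to the cubes consulted. *)
have [|S SE] := @strong_recursion cube (fun P => absz (rank P - rank top))
  (fun S P => valid P /\ (P = top \/ exists Q, [/\ S Q, below Q P, stops Q P
    & forall Q0 : cube, S Q0 -> below Q0 P -> descends P Q0 -> rank Q0 <= rank Q])).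
  move=> S S' P SS'.
  have {}SS' Q : below Q P -> S Q <-> S' Q.
    by rewrite /below => QP; apply: SS'; lia.
  split=> -[vP [Ptop|[Q [SQ QP PQ PS]]]]; (split=> //); (try by left); right;
    exists Q; split=> //; (try by apply/(SS' Q QP)) => Q0 SQ0 Q0P;
    by apply: (PS Q0 _ Q0P); apply/(SS' Q0 Q0P).
have Sv P : S P -> valid P /\ rank top <= rank P.
  move=> /SE[vP [->//|[Q [_ /andP[tQ QP] _ _]]]]; split=> //; lia.
exists S; split=> //.
- by apply/SE; split=> //; left.
- move=> P /SE[vP [->|[Q [SQ QP PQ PS]]]]; [by left|right].
  exists Q; split=> // Q0 SQ0 PQ0; apply: PS => //.
  by rewrite /below (descends_rank PQ0) andbT; have [] := Sv _ SQ0.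
- move=> P Q SQ PQ; apply: contrapT => noQ1.
  have [vQ tQ] := Sv _ SQ.
  have QP := stops_rank vQ PQ.
  (* If no selected cube serves as [Q1], nothing blocks [P]: a blocking cube would contain [P] and
     have rank above that of [Q], hence be such a [Q1]. *)
  suff SP : S P by apply: noQ1; exists P; split.
  apply/SE; split; first by case: PQ.
  right; exists Q; split=> //; first by rewrite /below tQ.
  move=> Q0 SQ0 _ [_ _ PQ0]; rewrite leNgt; apply/negP => QQ0.
  by apply: noQ1; exists Q0.
Qed.

Hypothesis valid_countable : countable valid.
Variables (top : cube) (S : set cube).
Hypothesis S_valid : forall P, S P -> valid P /\ rank top <= rank P.
Hypothesis S_parent : forall P, S P -> P = top \/ exists Q, [/\ S Q, stops Q P
  & forall Q0 : cube, S Q0 -> descends P Q0 -> rank Q0 <= rank Q].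

Definition children (a : A) Q := [set P | [/\ P.1 = a, S P, stops Q P
  & forall Q0 : cube, S Q0 -> descends P Q0 -> rank Q0 <= rank Q]].

(** The cutoff [N] makes induction on scales possible; it is removed in [stopping_sparse]. *)
Definition descendants (N : int) Q :=
  [set P | [/\ S P, descends P Q & rank P <= N]].

Definition union (E : set cube) := \bigcup_(P in E) P.2.2.

Lemma valid_disjoint P Q : valid P -> valid Q -> P.1 = Q.1 -> P != Q ->
  [\/ P.2.2 `&` Q.2.2 = set0, descends P Q | descends Q P].
Proof.
case: P Q => [a [k P]] [b [l Q]] /= vP vQ /= ab PQ; subst b.
have [Pne Qne] : (exists x, P x) /\ (exists x, Q x).
  have ne b m (E : set X) : D b m E -> exists x, E x.
    move=> vE; apply: contrapT => noE.
    have := @valid_measure (b, (m, E)) vE => /=.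
    rewrite (_ : E = set0) ?measure0 ?ltxx//.
    by rewrite -subset0 => x Ex; apply: noE; exists x.
  by split; [exact: ne vP|exact: ne vQ].
have [kl|lk|kl] := ltgtP k l.
- have [QP|] := nested (ltW kl) vQ vP; first by apply: Or33.
  by rewrite setIC; apply: Or31.
- have [QP|] := nested (ltW lk) vP vQ; first by apply: Or32.
  by apply: Or31.
subst l; have [PQs|] := nested (lexx k) vP vQ; last by apply: Or31.
have [QPs|] := nested (lexx k) vQ vP; last by rewrite setIC; apply: Or31.
by case/eqP: PQ; congr (_, (_, _)); apply/seteqP.
Qed.

(* The selection rule makes the children of [Q] in one system disjoint: a child
   containing another one has larger rank than [Q] and would have prevented the
   selection of the smaller one. *)
Lemma children_measure a Q : S Q ->
  measurable (union (children a Q)) /\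
  (mu (union (children a Q)) <= (K' * eps)%:E * mu Q.2.2)%E.
Proof.
move=> /S_valid[vQ _].
have K'0 : 0 <= K' by rewrite (le_trans _ K'_ge1).
have Cv P : children a Q P -> valid P by move=> [_ /S_valid[]].
apply: measure_countable_cover.
- by rewrite mule_ge0// lee_fin mulr_ge0// ltW.
- by apply: sub_countable valid_countable; apply: subset_card_le => P /Cv.
- by move=> P /Cv /valid_measurable.
move=> J uJ JC.
apply: (@le_trans _ _ (\sum_(P <- J) K'%:E * mu (P.2.2 `&` Om Q)))%E.
  rewrite big_seq [leRHS]big_seq; apply: lee_sum => P /JC.
  by move=> [_ _ []].
rewrite -ge0_sume_distrr// EFinM -muleA; apply: lee_wpmul2l => //.
apply: le_trans (Om_measure vQ).
apply: (@sum_measure_disjoint _ _ _ mu _ (fun P => P.2.2 `&` Om Q)) => //.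
- exact: Om_measurable.
- move=> P /JC /Cv vP; split=> //.
  by apply: measurableI; [exact: valid_measurable|exact: Om_measurable].
have main P P' : children a Q P -> children a Q P' -> ~ descends P P'.
  move=> [_ _ _ PQ] [_ SP' QP' _] PP'.
  by have := stops_rank vQ QP'; rewrite ltNge PQ.
move=> P P' /JC CP /JC CP' PP'.
have [|||e|/main|/main] := valid_disjoint _ _ _ PP'.
- exact: Cv.
- exact: Cv.
- by case: CP CP' => -> _ _ _ [-> _ _ _].
- by rewrite setIACA e set0I.
- by move=> /(_ CP CP').
- by move=> /(_ CP' CP).
Qed.

Definition residual N Q := Q.2.2 `\` union (descendants N Q).

Lemma descendants_measurable N Q : measurable (union (descendants N Q)).
Proof.
have Sv P : descendants N Q P -> valid P by case=> /S_valid[].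
have [] := @measure_countable_cover _ _ _ mu _ (fun P : cube => P.2.2)
   (descendants N Q) +oo%E => //.
- by apply: sub_countable valid_countable; apply: subset_card_le => P /Sv.
- by move=> P /Sv /valid_measurable.
- by move=> *; rewrite leey.
Qed.

Lemma residual_disjoint N P Q : S P -> S Q -> rank P <= N -> rank Q <= N ->
  P.1 = Q.1 -> P != Q -> residual N P `&` residual N Q = set0.
Proof.
move=> SP SQ PN QN PQ1 PQ; have [vP _] := S_valid SP; have [vQ _] := S_valid SQ.
rewrite -subset0 => x [[Px nPx] [Qx nQx]].
have [e|PdQ|QdP] := valid_disjoint vP vQ PQ1 PQ.
- by have : (P.2.2 `&` Q.2.2) x by []; rewrite e.
- by apply: nQx; exists P.
- by apply: nPx; exists Q.
Qed.

Lemma half_residual Q (U : set X) : valid Q -> measurable U ->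
  (mu U <= 2^-1%:E * mu Q.2.2)%E -> (2^-1%:E * mu Q.2.2 <= mu (Q.2.2 `\` U))%E.
Proof.
move=> vQ mU leU; have mQ := valid_measurable vQ.
have /andP[Q0 Qoo] := valid_measure vQ.
have fin (E : set X) : measurable E -> E `<=` Q.2.2 -> mu E \is a fin_num.
  move=> mE EQ; rewrite ge0_fin_numE//; apply: le_lt_trans Qoo.
  exact: measure_subset.
have mD : measurable (Q.2.2 `\` U) by exact: measurableD.
have mI : measurable (Q.2.2 `&` U) by exact: measurableI.
have : (mu (Q.2.2 `&` U) <= 2^-1%:E * mu Q.2.2)%E.
  by apply: le_trans leU; apply: measure_subset.
have -> : mu Q.2.2 = (mu (Q.2.2 `\` U) + mu (Q.2.2 `&` U))%E by exact: measureDI.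
have : mu (Q.2.2 `\` U) \is a fin_num by exact: fin.
have : mu (Q.2.2 `&` U) \is a fin_num by apply: fin.
move=> /fineK <- /fineK <-.
rewrite -EFinD -!EFinM !lee_fin.
lra.
Qed.

(** A descendant [P] of [Q0] is a child of some selected [Q]. By the selection rule [Q] is not
    larger than [Q0], and it meets [P], so it lies in [star Q0]. Hence the children, in the system
    of [Q0], of the cubes in [I] cover all descendants. Their total measure is at most [K' eps]
    times the sum of [mu Q] over [I], and each system contributes at most [2 K mu Q0] to that
    sum. *)
Lemma descendants_measure_step N :
  (forall Q, S Q -> (mu (union (descendants (N - 1) Q)) <= 2^-1%:E * mu Q.2.2)%E) ->
  forall Q, S Q -> (mu (union (descendants N Q)) <= 2^-1%:E * mu Q.2.2)%E.
Proof.
move=> IH Q0 SQ0; have [v0 t0] := S_valid SQ0.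
pose I := [set Q | [/\ S Q, rank Q <= N - 1 & Q.2.2 `<=` star Q0]].
pose V Q := union (children Q0.1 Q).
have K0 : 0 <= K by rewrite (le_trans _ K_ge1).
have K'0 : 0 <= K' by rewrite (le_trans _ K'_ge1).
have e0 := ltW eps_gt0.
have subIV : union (descendants N Q0) `<=` \bigcup_(Q in I) V Q.
  move=> x [P [SP PQ0 PN] Px].
  have rPQ0 := descends_rank PQ0.
  have [Ptop|[Q [SQ QP Qbig]]] := S_parent SP.
    by move: rPQ0; rewrite Ptop ltNge t0.
  have [vQ _] := S_valid SQ.
  have QrP := stops_rank vQ QP.
  have [y [Py Qy]] := stops_meets vQ QP.
  exists Q.
    split=> //; first by lia.
    apply: (@star_sub Q0 Q y) => //; first exact: Qbig.
    by case: PQ0 => _ _; apply.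
  by exists P => //; split=> //; case: PQ0.
have [||||mV leV] := @measure_countable_cover _ _ _ mu _ V I (2^-1%:E * mu Q0.2.2)%E.
- by rewrite mule_ge0.
- apply: sub_countable valid_countable; apply: subset_card_le => Q.
  by case=> /S_valid[].
- by move=> Q [SQ _ _]; have [] := children_measure Q0.1 SQ.
- move=> J uJ JI.
  (* By the induction hypothesis each [Q] keeps half its measure in its residual, and the residuals
     of one system are disjoint inside [star Q0]. *)
  have sumb (b : A) : (\sum_(Q <- J | Q.1 == b) mu Q.2.2 <= (2 * K)%:E * mu Q0.2.2)%E.
    rewrite -big_filter; set Jb := [seq _ <- _ | _].
    have JbI Q : Q \in Jb -> I Q /\ Q.1 = b.
      by rewrite mem_filter => /andP[/eqP ? /JI].
    apply: (@le_trans _ _ (\sum_(Q <- Jb) 2%:E * mu (residual (N - 1) Q)))%E.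
      rewrite big_seq [leRHS]big_seq; apply: lee_sum => Q /JbI[[SQ QN _] _].
      have [vQ _] := S_valid SQ.
      have := half_residual vQ (descendants_measurable _ _) (IH _ SQ).
      move=> /(@lee_wpmul2l _ 2%:E) => /(_ ltac:(by rewrite lee_fin)).
      by rewrite muleA -EFinM divff// mul1e.
    rewrite -ge0_sume_distrr// EFinM -muleA; apply: lee_wpmul2l => //.
    apply: le_trans (star_measure v0).
    apply: sum_measure_disjoint.
    + exact: filter_uniq.
    + exact: star_measurable.
    + move=> Q /JbI[[SQ QN Qs] _]; split; last by apply: subset_trans Qs; exact: subDsetl.
      apply: measurableD (descendants_measurable _ _).
      by apply: valid_measurable; have [] := S_valid SQ.
    + move=> P Q /JbI[[SP PN _] Pb] /JbI[[SQ QN _] Qb] PQ.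
      by apply: residual_disjoint => //; rewrite Pb Qb.
  apply: (@le_trans _ _ ((K' * eps)%:E * \sum_(Q <- J) mu Q.2.2))%E.
    rewrite ge0_sume_distrr//; rewrite big_seq [leRHS]big_seq.
    by apply: lee_sum => Q /JI[SQ _ _]; have [] := children_measure Q0.1 SQ.
  apply: (@le_trans _ _ ((K' * eps)%:E * (\sum_(b : A) (2 * K)%:E * mu Q0.2.2)))%E.
    apply: lee_wpmul2l; first by rewrite lee_fin mulr_ge0.
    rewrite (partition_big (fun Q : cube => Q.1) predT)//=.
    by apply: lee_sum => b _; exact: sumb.
  have /andP[Q0gt Q0oo] := valid_measure v0.
  rewrite -(@fineK _ (mu Q0.2.2)) ?ge0_fin_numE// -EFinM sumEFin.
  rewrite -!EFinM lee_fin sumr_const.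
  set z := fine _; have z0 : 0 <= z by rewrite fine_ge0.
  have KK0 : 0 <= K * K' * eps by rewrite !mulr_ge0.
  have : #|A|%:R * (K * K' * eps) <= #|A|.+1%:R * (K * K' * eps).
    by apply: ler_wpM2r => //; rewrite ler_nat.
  have small : 4 * (#|A|.+1%:R * (K * K' * eps)) <= 1.
    by move: eps_small; rewrite -!mulrA.
  move=> le1; have : 4 * (#|A|%:R * (K * K' * eps)) <= 1.
    by apply: le_trans small; rewrite ler_pM2l.
  move=> /(ler_wpM2r z0); rewrite -mulr_natl.
  set c := #|A|%:R; lra.
apply: le_trans leV; apply: measure_subset => //.
exact: descendants_measurable.
Qed.

Lemma descendants_measure N Q : S Q ->
  (mu (union (descendants N Q)) <= 2^-1%:E * mu Q.2.2)%E.
Proof.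
(* For [N] below [rank top] there are no descendants, which starts the induction. *)
have [j] : exists j : nat, N < rank top + j%:Z.
  by exists (absz (N - rank top)).+1; lia.
elim: j N Q => [|j IH] N Q Nj SQ; last first.
  by apply: descendants_measure_step => // P; apply: IH; lia.
rewrite (_ : union _ = set0) ?measure0 ?mule_ge0//.
rewrite -subset0 => x [P [SP _ PN] _].
have [_] := S_valid SP; lia.
Qed.

(** Take [E(Q)] to be [Q] minus all selected cubes strictly below it in the same system. Finitely
    many such cubes have bounded rank, so the truncated bound controls every finite union and hence
    the whole union. *)
Lemma stopping_sparse a : sparse mu 2^-1 [set Q | S (a, Q)].
Proof.
pose U Q := union [set P | S P /\ descends P Q].
have mU Q : S Q -> measurable (U Q) /\ (mu (U Q) <= 2^-1%:E * mu Q.2.2)%E.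
  move=> SQ; apply: measure_countable_union.
  - by rewrite mule_ge0.
  - apply: sub_countable valid_countable; apply: subset_card_le => P.
    by case=> /S_valid[].
  - by move=> P [/S_valid[/valid_measurable]].
  move=> J JS.
  have [N JN] : exists N : int, forall P, P \in J -> rank P <= N.
    elim: J {JS} => [|P J [N JN]]; first by exists 0.
    exists (Num.max (rank P) N) => P'; rewrite in_cons le_max => /orP[/eqP ->|/JN ->].
      by rewrite lexx.
    by rewrite orbT.
  apply: le_trans (descendants_measure N SQ).
  apply: measure_subset.
  - have [] // := @measure_seq_cover _ _ _ mu _ (fun P : cube => P.2.2) J.
    by move=> P /JS[/S_valid[/valid_measurable]].
  - exact: descendants_measurable.
  - by move=> x [P /= PJ Px]; exists P => //; have [] := JS P PJ; split=> //; apply: JN.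
exists (fun Q : int * set X => Q.2 `\` U (a, Q)); split.
- move=> Q SQ; apply: measurableD; last by have [] := mU _ SQ.
  by apply: (@valid_measurable (a, Q)); have [] := S_valid SQ.
- by move=> Q _; exact: subDsetl.
- move=> Q SQ; have [mUQ leUQ] := mU _ SQ.
  by apply: (@half_residual (a, Q)) => //; have [] := S_valid SQ.
- apply/trivIsetP => P Q SP SQ PQ.
  have [vP _] := S_valid SP; have [vQ _] := S_valid SQ.
  rewrite -subset0 => x [[Px nPx] [Qx nQx]].
  have [||e|PdQ|QdP] := valid_disjoint vP vQ.
  + by [].
  + by apply: contra_neq PQ => -[].
  + by have : (P.2 `&` Q.2) x by []; rewrite e.
  + by apply: nQx; exists (a, P).
  + by apply: nPx; exists (a, Q).
Qed.

End stopping.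

(** * Geometry of dyadic cubes in a space of homogeneous type *)

Section homogeneous_type.
Context {R : realType} {d : measure_display} {X : measurableType d}.
Variables (rho : X -> X -> R) (mu : {measure set X -> \bar R}).

Lemma qballS x (r r' : R) : r <= r' -> qball rho x r `<=` qball rho x r'.
Proof. by move=> rr' y; rewrite /qball /= => /lt_le_trans; apply. Qed.

Lemma quasi_metric_const : quasi_metric rho -> exists A0 : R, 1 <= A0 /\
  forall x y z, rho x y <= A0 * (rho x z + rho z y).
Proof.
move=> [rho0 _ _ [A0 H]]; exists (Num.max 1 A0); split; first by rewrite le_max lexx.
move=> x y z; apply: (le_trans (H x y z)); apply: ler_wpM2r.
  by rewrite addr_ge0.
by rewrite le_max lexx orbT.
Qed.

Lemma doubling_dilate : space_of_homogeneous_type rho mu ->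
  forall C : R, exists K : R, 1 <= K /\ forall x r, 0 < r ->
    (mu (qball rho x (C * r)) <= K%:E * mu (qball rho x r))%E.
Proof.
move=> [_ mB _ [A1 HA1]] C.
pose A2 := Num.max 1 A1.
have A21 : 1 <= A2 by rewrite le_max lexx.
have iter m x r : 0 < r ->
    (mu (qball rho x (2 ^+ m * r)) <= (A2 ^+ m)%:E * mu (qball rho x r))%E.
  move=> r0; elim: m => [|m IH]; first by rewrite !expr0 mul1r mul1e.
  rewrite exprS -mulrA; apply: le_trans (HA1 _ _ _) _; first by rewrite mulr_gt0 ?exprn_gt0.
  rewrite exprS EFinM -muleA; apply: (@le_trans _ _ (A2%:E * mu (qball rho x (2 ^+ m * r))))%E.
    by apply: lee_wpmul2r => //; rewrite lee_fin le_max lexx orbT.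
  by apply: lee_wpmul2l => //; rewrite lee_fin (le_trans _ A21).
pose m := (Num.trunc C).+1.
exists (A2 ^+ m); split; first exact: exprn_ege1.
move=> x r r0; apply: le_trans (iter m x r r0); apply: measure_subset => //.
apply: qballS; apply: ler_wpM2r; first exact: ltW.
apply: (le_trans (ltW (truncnS_gt C))).
by rewrite -natrX ler_nat; apply: ltnW; exact: ltn_expl.
Qed.

Lemma finite_bound (A : finType) (f : A -> R) : exists M, 0 < M /\ forall a, f a <= M.
Proof.
exists (1 + \sum_a `|f a|); split.
  by rewrite ltr_pwDl// sumr_ge0.
move=> a; rewrite (bigD1 a)//=.
have : 0 <= \sum_(i | i != a) `|f i| by rewrite sumr_ge0.
have := ler_norm (f a); lra.
Qed.

Lemma finite_pos_bound (A : finType) (f : A -> R) : (forall a, 0 < f a) ->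
  exists M, 0 < M /\ forall a, M <= f a.
Proof.
move=> f0; have [M [M0 HM]] := finite_bound (fun a => (f a)^-1).
exists M^-1; split; first by rewrite invr_gt0.
by move=> a; rewrite -[leRHS]invrK lef_pV2 ?posrE ?invr_gt0.
Qed.

(* Different systems have different ratios [delta]; measuring all of them by
   the powers of the largest one puts every cube on a common integer scale. *)
Lemma common_scale (A : finType) (D : A -> int -> set (set X)) :
  (forall a, dyadic_cubes rho mu (D a)) ->
  exists (L c1 C1 : R) (n : A -> int -> int),
    [/\ 0 < L, 0 < c1, 0 < C1, forall a k l, k < l -> n a k < n a l
      & forall a k Q, D a k Q -> exists z,
        qball rho z (c1 * expR (- (L * (n a k)%:~R))) `<=` Q /\
        Q `<=` qball rho z (C1 * expR (- (L * (n a k)%:~R)))].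
Proof.
move=> cD.
have /choice[par parP] (a : A) : exists p : R * R * R,
    [/\ 0 < p.1.1 < 1, 0 < p.1.2, p.1.2 <= p.2
      & forall (k : int) Q, D a k Q -> exists z : X,
          qball rho z (p.1.2 * p.1.1 ^ k) `<=` Q /\
          Q `<=` qball rho z (p.2 * p.1.1 ^ k)].
  by have [_ [dl [c [C H]]]] := cD a; exists (dl, c, C).
pose lam a := - ln (par a).1.1.
have lam0 a : 0 < lam a.
  by rewrite oppr_gt0; apply: ln_lt0; have [] := parP a.
have [L [L0 Llam]] := finite_pos_bound lam0.
have [c [c0 Hc]] : exists M, 0 < M /\ forall a, M <= (par a).1.2.
  by apply: finite_pos_bound => a; have [] := parP a.
have [C [C0 HC]] := finite_bound (fun a => (par a).2).
pose n a (k : int) := Num.floor (k%:~R * (lam a / L)).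
(* The floor in [n] enlarges the scale by a factor less than [expR L]; the inner radius pays for
   it. *)
exists L, (c * expR (- L)), C, n; split=> //.
- by rewrite mulr_gt0// expR_gt0.
- move=> a k l kl.
  (* Since the slope is at least 1, consecutive generations have distinct floors. *)
  have LL : 1 <= lam a / L by rewrite ler_pdivlMr// mul1r.
  have : k%:~R * (lam a / L) + 1 <= l%:~R * (lam a / L).
    apply: (@le_trans _ _ ((k + 1)%:~R * (lam a / L))).
      by rewrite intrD mulrDl mul1r lerD2l.
    apply: ler_wpM2r; first by rewrite (le_trans _ LL).
    by rewrite ler_int; lia.
  move=> kl1.
  suff : n a k + 1 <= n a l by lia.
  rewrite /n floor_ge_int intrD; apply: le_trans kl1.
  by rewrite lerD2r floor_le.
move=> a k Q DQ; have [dl01 cp cC H] := parP a.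
have [z [zQ Qz]] := H k Q DQ; exists z.
have dl0 : 0 < (par a).1.1 by case/andP: dl01.
have dE : (par a).1.1 ^ k = expR (- (k%:~R * lam a)).
  rewrite /lam mulrN opprK mulrC expRM lnK ?posrE//.
  by rewrite powR_intmul// ltW.
have /andP[n1 n2] : L * (n a k)%:~R <= k%:~R * lam a < L * (n a k)%:~R + L.
  have := floor_itv (k%:~R * (lam a / L)); rewrite -/(n a k) intrD => /andP[f1 f2].
  have e : k%:~R * lam a = L * (k%:~R * (lam a / L)).
    by rewrite mulrCA [L * _]mulrC divfK// gt_eqF.
  rewrite e ler_pM2l// f1/=.
  by move: f2; rewrite -(ltr_pM2l L0) mulrDr mulr1.
split.
- apply: subset_trans zQ; apply: qballS.
  rewrite -mulrA -expRD dE; apply: ler_pM => //; rewrite ?(ltW c0) ?expR_ge0//.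
  rewrite ler_expR; lra.
- apply: (subset_trans Qz); apply: qballS.
  rewrite dE; apply: ler_pM => //.
  + exact: le_trans (ltW cp) cC.
  + by rewrite ler_expR lerN2.
Qed.

(** This gathers all the geometry that the stopping and domination arguments consume. *)
Lemma cube_geometry (A : finType) (D : A -> int -> set (set X)) (x0 : X) :
  space_of_homogeneous_type rho mu ->
  (forall a, dyadic_cubes rho mu (D a)) ->
  adjacent_systems rho D ->
  exists (n : A -> int -> int) (K K' : R) (star : A * (int * set X) -> set X),
  [/\ forall a k l, k < l -> n a k < n a l,
      1 <= K /\ 1 <= K',
      forall Q, valid D Q -> measurable Q.2.2 /\ (0 < mu Q.2.2 < +oo)%E,
      countable (valid D)
   &  [/\ forall Q, valid D Q ->
             measurable (star Q) /\ (mu (star Q) <= K%:E * mu Q.2.2)%E,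
          forall P Q x, valid D P -> valid D Q -> rank n P <= rank n Q ->
            P.2.2 x -> Q.2.2 x -> Q.2.2 `<=` star P,
          forall y s, 0 < s -> exists P, [/\ valid D P,
            qball rho y (2 * s) `<=` P.2.2
            & (mu P.2.2 <= K'%:E * mu (qball rho y s))%E]
        & forall s, 0 < s -> exists N : int, forall Q y, valid D Q ->
            N <= rank n Q -> Q.2.2 y -> Q.2.2 `<=` qball rho y s]].
Proof.
move=> hX cD [C3 adj].
have [qm mB Bpos _] := hX.
have [_ rhoC _ _] := qm.
have [A0 [A01 rhoA]] := quasi_metric_const qm.
have A0gt : 0 < A0 by exact: lt_le_trans A01.
have [L [c1 [C1 [n [L0 c10 C10 nmono HD]]]]] := common_scale cD.
pose r (Q : A * (int * set X)) := expR (- (L * (rank n Q)%:~R)).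
have r0 Q : 0 < r Q by exact: expR_gt0.
have /choice[z zP] (Q : A * (int * set X)) : exists z, valid D Q ->
    qball rho z (c1 * r Q) `<=` Q.2.2 /\ Q.2.2 `<=` qball rho z (C1 * r Q).
  have [vQ|nvQ] := pselect (valid D Q); last by exists x0.
  by have [z zP] := HD _ _ _ vQ; exists z.
have zsub Q : valid D Q -> qball rho (z Q) (c1 * r Q) `<=` Q.2.2.
  by move=> /zP[].
have subz Q y : valid D Q -> Q.2.2 y -> rho (z Q) y < C1 * r Q.
  by move=> /zP[_ +] Qy => /(_ y Qy).
have mQ Q : valid D Q -> measurable Q.2.2.
  by move=> vQ; have [[mD _ _] _] := cD Q.1; exact: mD vQ.
have QQ Q y w : valid D Q -> Q.2.2 y -> Q.2.2 w -> rho y w < A0 * (2 * C1 * r Q).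
  move=> vQ /(subz _ _ vQ) Qy /(subz _ _ vQ) Qw.
  apply: (le_lt_trans (rhoA y w (z Q))).
  rewrite ltr_pM2l// rhoC; lra.
(* From the centre of [P] go to a common point of [P] and [Q], then across [Q], whose diameter is at
   most [A0 * (2 * C1)] times its scale. [K] compares this ball with the inner ball of [P], and [K']
   compares [B(y, C3 * 2s)] with [B(y, s)]. *)
pose Cs := A0 * (C1 + A0 * (2 * C1)).
have [K [K1 HK]] := doubling_dilate hX (Cs / c1).
have [K' [K'1 HK']] := doubling_dilate hX (C3 * 2).
exists n, K, K', (fun Q => qball rho (z Q) (Cs * r Q)); split=> //.
- move=> Q vQ; split; first exact: mQ.
  have /andP[b0 _] := Bpos (z Q) _ (mulr_gt0 c10 (r0 Q)).
  have /andP[_ boo] := Bpos (z Q) _ (mulr_gt0 C10 (r0 Q)).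
  apply/andP; split.
    by apply: lt_le_trans b0 _; apply: measure_subset; [|exact: mQ|exact: zsub].
  apply: le_lt_trans boo; apply: measure_subset => //; first exact: mQ.
  by move=> y; exact: subz.
(* Fixing the system, the generation and an enclosing ball around [x0] leaves disjoint sets of
   positive measure in a set of finite measure. *)
- pose I (p : A * int * nat) := [set Q : A * (int * set X) |
    [/\ valid D Q, Q.1 = p.1.1, Q.2.1 = p.1.2 & Q.2.2 `<=` qball rho x0 p.2.+1%:R]].
  have vI : valid D `<=` \bigcup_(p in [set: A * int * nat]) I p.
    move=> Q vQ; exists ((Q.1, Q.2.1), Num.trunc (A0 * (rho x0 (z Q) + C1 * r Q))) => //.
    split=> //= y Qy; apply: le_lt_trans (truncnS_gt _).
    apply: (le_trans (rhoA _ _ (z Q))); rewrite ler_pM2l// lerD2l.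
    by apply/ltW/subz.
  apply: (sub_countable (subset_card_le vI)).
  apply: bigcup_countable => [|p _]; first exact: countableP.
  have /andP[_ Boo] := Bpos x0 p.2.+1%:R (ltr0Sn _ _).
  apply: (@countable_disjoint_family _ _ _ mu _ (fun Q : A * (int * set X) => Q.2.2)
    (I p) (qball rho x0 p.2.+1%:R)) => //.
    move=> Q [vQ _ _ Qb]; split=> //; first exact: mQ.
    have /andP[b0 _] := Bpos (z Q) _ (mulr_gt0 c10 (r0 Q)).
    by apply: lt_le_trans b0 _; apply: measure_subset; [|exact: mQ|exact: zsub].
  move=> [a [k P]] [b [l Q]] [vP /= aP kP _] [vQ /= bQ lQ _].
  rewrite {}aP {}kP {}bQ {}lQ in vP vQ *.
  have [[_ _ nest] _] := cD p.1.1.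
  have [PQ|//] := nest _ _ (lexx _) _ _ vP vQ.
  have [QP|] := nest _ _ (lexx _) _ _ vQ vP; last by rewrite setIC.
  by case/eqP; congr (_, (_, _)); apply/seteqP.
split.
- move=> Q vQ; split; first exact: mB.
  have -> : Cs * r Q = Cs / c1 * (c1 * r Q) by rewrite mulrA divfK// gt_eqF.
  apply: (le_trans (HK _ _ (mulr_gt0 c10 (r0 Q)))).
  apply: lee_wpmul2l; first by rewrite lee_fin (le_trans _ K1).
  by apply: measure_subset; [exact: mB|exact: mQ|exact: zsub].
- move=> P Q x vP vQ PQ Px Qx y Qy; rewrite /qball /=.
  apply: (le_lt_trans (rhoA _ _ x)); rewrite /Cs -mulrA ltr_pM2l// mulrDl.
  apply: ltrD; first exact: subz.
  apply: (lt_le_trans (QQ Q x y vQ Qx Qy)).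
  rewrite -!mulrA ler_pM2l// ler_pM2l// ler_pM2l//.
  by rewrite ler_expR lerN2 ler_pM2l// ler_int.
- move=> y s s0; have [a [k [Q [DQ BQ QB]]]] := adj y (2 * s) (mulr_gt0 (ltr0Sn R 1) s0).
  exists (a, (k, Q)); split=> //=.
  apply: le_trans (HK' _ _ s0); apply: measure_subset => //; last by rewrite -mulrA.
  exact: (mQ (a, (k, Q))).
- move=> s s0.
  pose M := A0 * (2 * C1) / s.
  exists (Num.floor (M / L) + 1) => Q y vQ NQ Qy w Qw.
  apply: (lt_le_trans (QQ Q y w vQ Qy Qw)).
  (* Rank at least [M / L] suffices, by [1 + u <= expR u]. *)
  have : M <= expR (L * (rank n Q)%:~R).
    apply: le_trans (expR_ge1Dx _).
    have : M / L <= (rank n Q)%:~R.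
      apply: (le_trans (ltW (floorD1_gt _))); by rewrite ler_int.
    rewrite ler_pdivrMr// mulrC => ?; lra.
  rewrite /r expRN ler_pdivrMr// => ?.
  by rewrite mulrA ler_pdivrMr ?expR_gt0// [leRHS]mulrC.
Qed.

End homogeneous_type.

(** * Pointwise domination by chains of selected cubes *)

Section domination.
Context {R : realType} {d : measure_display} {X : measurableType d}.
Variables (rho : X -> X -> R) (mu : {measure set X -> \bar R}).

(** Superlevel sets of the maximal operator may fail to be measurable, so only their outer measure
    is controlled. As [0 < mu Q < +oo], doubling [e] makes the bound strict and yields an actual
    countable cover, which is then cut down to [Q]. *)
Lemma measurable_hull (E Q : set X) (e : R) : measurable Q -> E `<=` Q ->
  0 < e -> (0 < mu Q < +oo)%E -> (mu_ext mu E <= e%:E * mu Q)%E ->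
  exists H, [/\ measurable H, E `<=` H, H `<=` Q & (mu H <= (2 * e)%:E * mu Q)%E].
Proof.
move=> mQ EQ e0 /andP[Q0 Qoo] le_ext.
have fQ : mu Q \is a fin_num by rewrite ge0_fin_numE.
have lt_ext : (mu_ext mu E < (2 * e)%:E * mu Q)%E.
  apply: (le_lt_trans le_ext).
  by rewrite lte_pmul2r// lte_fin; lra.
have [_ [G [mG EG] <-] ltG] := ereal_inf_lt lt_ext.
exists (\bigcup_k G k `&` Q); split.
- by apply: measurableI => //; exact: bigcup_measurable.
- by move=> x Ex; split; [exact: EG|exact: EQ].
- by move=> x [].
apply: le_trans (ltW ltG).
have mGG : measurable (\bigcup_k G k) by exact: bigcup_measurable.
apply: (@le_trans _ _ (mu (\bigcup_k G k))).
  by apply: measure_subset => //; exact: measurableI.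
by apply: measure_sigma_subadditive.
Qed.

Lemma le_nontangential_max (Q : set X) (F : X -> R -> R -> \bar R) x y s t :
  0 < s -> rho x y < s -> s < t -> qball rho y t `<=` Q -> Q x ->
  (F y s t <= nontangential_max rho Q F x)%E.
Proof.
move=> s0 xys st BQ Qx; rewrite /nontangential_max indicE mem_set// mul1e.
apply: ereal_sup_ubound; right; exists y, s, t; split=> //.
apply: le_ereal_inf_tmp => _ [w nQw <-]; rewrite lee_fin leNgt.
by apply/negP => yw; exact: nQw (BQ _ yw).
Qed.

Context {A : finType}.
Variables (D : A -> int -> set (set X)) (n : A -> int -> int).
Variables (Om : A * (int * set X) -> set X) (K' : R) (S : set (A * (int * set X))).
Variables (F : X -> R -> R -> \bar R) (c : int * set X -> R).

Hypothesis rho_sym : forall x y, rho x y = rho y x.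
Hypothesis rho_refl : forall x, rho x x = 0.
Hypothesis monoF : monotonic_fun F.
Hypothesis subaddF : subadditive_fun F.
Hypothesis ball_measurable : forall x r, measurable (qball rho x r).
Hypothesis valid_measurable : forall Q, valid D Q -> measurable Q.2.2.
Hypothesis Om_measurable : forall Q, valid D Q -> measurable (Om Q).
Hypothesis K'_ge0 : 0 <= K'.
Hypothesis Om_proper : forall Q, valid D Q -> ~ Q.2.2 `<=` Om Q.
Hypothesis c_ge0 : forall Q, valid D Q -> 0 <= c Q.2.
Hypothesis Om_max : forall Q x, valid D Q -> ~ Om Q x ->
  (nontangential_max rho Q.2.2 F x <= (c Q.2)%:E)%E.
Hypothesis adjacent : forall y s, 0 < s -> exists P, [/\ valid D P,
  qball rho y (2 * s) `<=` P.2.2 & (mu P.2.2 <= K'%:E * mu (qball rho y s))%E].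
Hypothesis shrink : forall s, 0 < s -> exists N : int, forall Q y, valid D Q ->
  N <= rank n Q -> Q.2.2 y -> Q.2.2 `<=` qball rho y s.
Hypothesis S_valid : forall P, S P -> valid D P.
Hypothesis S_cover : forall P Q, S Q -> stops mu D Om K' Q P ->
  exists Q1, [/\ S Q1, P.2.2 `<=` Q1.2.2 & rank n Q < rank n Q1].

(** If doubling never left [E], the balls [B(y, 2^m s)] would exhaust the space inside [E]. *)
Lemma last_contained_dilate (E : set X) y s : 0 < s -> ~ [set: X] `<=` E ->
  qball rho y s `<=` E -> exists s', [/\ s <= s', qball rho y s' `<=` E
    & exists2 x, qball rho y (2 * s') x & ~ E x].
Proof.
move=> s0 nE sE; apply: contrapT => no.
have all m : qball rho y (2 ^+ m * s) `<=` E.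
  elim: m => [|m IH]; first by rewrite expr0 mul1r.
  apply: contrapT => nm; apply: no; exists (2 ^+ m * s); split=> //.
    by rewrite -[leLHS]mul1r ler_pM2r// exprn_ege1// ler1n.
  apply: contrapT => nox; apply: nm => x Bx; apply: contrapT => nEx.
  by apply: nox; exists x => //; move: Bx; rewrite exprS mulrA.
apply: nE => x _; apply: (all (Num.trunc (rho y x / s)).+1).
rewrite /qball /= -ltr_pdivrMr//; apply: (lt_trans (truncnS_gt _)).
by rewrite -natrX ltr_nat; exact: ltn_expl.
Qed.

(** Induction on the number of scales between [Q] and the scale [N] at which cubes containing [y]
    fit into [B(y, s)]. All cubes of the chain contain a ball around [y] of radius above [s], hence
    also [x]. *)
Lemma chain_domination y s x Q t : 0 < s -> rho x y < s -> S Q -> s < t ->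
  qball rho y t `<=` Q.2.2 ->
  exists l : seq (A * (int * set X)), [/\ uniq l,
    forall P, P \in l -> [/\ S P, rank n Q <= rank n P & P.2.2 x]
    & (F y s t <= \sum_(P <- l) (c P.2)%:E)%E].
Proof.
move=> s0 xy.
(* A point [x'] of [B(y, s')] outside [Om Q'] has [F y s' t'] among the values in its supremum. *)
have stop Q' s' t' x' : S Q' -> 0 < s' -> s' < t' -> qball rho y t' `<=` Q'.2.2 ->
    qball rho y s' x' -> ~ Om Q' x' -> (F y s' t' <= (c Q'.2)%:E)%E.
  move=> SQ' s'0 s't' BQ' Bx' nOm; apply: le_trans (Om_max (S_valid SQ') nOm).
  apply: le_nontangential_max => //; first by rewrite rho_sym.
  by apply: BQ'; exact: lt_trans Bx' s't'.
have yt u : s < u -> qball rho y u x.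
  by move=> su; rewrite /qball /= rho_sym; exact: lt_trans xy su.
have escape Q' t' : S Q' -> s < t' -> qball rho y t' `<=` Q'.2.2 ->
    ~ qball rho y s `<=` Om Q' -> exists l : seq (A * (int * set X)), [/\ uniq l,
      forall P, P \in l -> [/\ S P, rank n Q' <= rank n P & P.2.2 x]
      & (F y s t' <= \sum_(P <- l) (c P.2)%:E)%E].
  move=> SQ' st' BQ' nBOm; exists [:: Q']; split=> //.
    by move=> P; rewrite inE => /eqP ->; split=> //; apply: BQ'; exact: yt.
  rewrite big_seq1; apply: contrapT => nF; apply: nBOm => x' Bx'.
  by apply: contrapT => nOm; apply: nF; exact: stop Bx' nOm.
have [N HN] := shrink s0.
have [j] : exists j : nat, N <= rank n Q + j%:Z.
  by exists (absz (N - rank n Q)); lia.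
elim: j Q t => [|j IH] Q t NQ SQ st BQ.
  (* At this scale [Q] lies in [B(y, s)], so containment of that ball in [Om Q] would give [Q]
     inside [Om Q]. *)
  apply: escape => // BOm; apply: (Om_proper (S_valid SQ)).
  apply: subset_trans BOm; apply: HN => //; [exact: S_valid|by lia|].
  by apply: BQ; rewrite /qball /= rho_refl; exact: lt_trans st.
have vQ := S_valid SQ.
have [BOm|nBOm] := pselect (qball rho y s `<=` Om Q); last exact: escape nBOm.
have [|s' [ss' BOm' [x' Bx' nOmx']]] := last_contained_dilate s0 _ BOm.
  by move=> all; apply: (Om_proper vQ) => w _; exact: all.
have s'0 : 0 < s' by exact: lt_le_trans ss'.
have [P [vP BP muP]] := adjacent y s'0.
have QP : stops mu D Om K' Q P.
  split=> //; apply: (le_trans muP); apply: lee_wpmul2l => //.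
  apply: measure_subset => //.
    by apply: measurableI; [exact: valid_measurable|exact: Om_measurable].
  move=> w Bw; split; last exact: BOm'.
  by apply: BP; apply: lt_trans Bw _; lra.
have [Q1 [SQ1 PQ1 QQ1]] := S_cover SQ QP.
have s's : s < 2 * s' by lra.
have BQ1 : qball rho y (2 * s') `<=` Q1.2.2 by exact: subset_trans PQ1.
have NQ1 : N <= rank n Q1 + j%:Z by lia.
have [l [ul lP leF]] := IH Q1 (2 * s') NQ1 SQ1 s's BQ1.
exists (Q :: l); split.
(* Ranks in the rest of the chain are at least that of [Q1], which exceeds that of [Q], so [Q] does
   not recur. *)
- rewrite /= ul andbT; apply/negP => /lP[_ + _].
  by rewrite leNgt QQ1.
- move=> P'; rewrite in_cons => /orP[/eqP ->|/lP[SP' Q1P' P'x]]; last first.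
    by split=> //; apply: le_trans Q1P'; exact: ltW.
  by split=> //; apply: BQ; exact: yt.
rewrite big_cons.
(* If [t] is at most [2 * s'], monotonicity alone suffices; otherwise the piece from [2 * s'] to [t]
   costs [c Q], witnessed by [x']. *)
have [ts'|s't] := leP t (2 * s').
  apply: (@le_trans _ _ (F y s (2 * s'))); first by apply: monoF => //; exact: ltW.
  apply: (le_trans leF); rewrite leeDr// lee_fin; exact: c_ge0.
apply: (@le_trans _ _ (F y s (2 * s') + F y (2 * s') t))%E.
  by apply: subaddF => //; exact: ltW.
rewrite addeC; apply: leeD => //.
by apply: stop Bx' nOmx' => //; lra.
Qed.

(** Sorting the chain by system gives a finite, repetition-free set of indices for each inner
    sum. *)
Lemma chain_le_sum x (l : seq (A * (int * set X))) : uniq l ->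
  (forall P, P \in l -> S P /\ P.2.2 x) ->
  (\sum_(P <- l) (c P.2)%:E <=
   \sum_(a : A) \esum_(Q in [set Q | S (a, Q)]) (\1_(Q.2) x * c Q)%:E)%E.
Proof.
move=> ul lS.
rewrite (partition_big (fun P : A * (int * set X) => P.1) predT)//=.
apply: lee_sum => a _; rewrite -big_filter; set la := [seq _ <- _ | _].
have laP P : P \in la -> [/\ S P, P.2.2 x & P = (a, P.2)].
  rewrite mem_filter => /andP[/eqP Pa /lS[SP Px]]; split=> //.
  by case: P Pa {SP Px} => b Q /= ->.
have ula : uniq (map snd la).
  rewrite map_inj_in_uniq ?filter_uniq// => P P' /laP[_ _ ->] /laP[_ _ ->] /=.
  by move=> ->.
apply: esum_ge; exists [set` map snd la].
  split; first by apply/finite_seqP; exists (map snd la).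
  by move=> _ /= /mapP[P /laP[SP _ PE] ->]; rewrite -PE.
rewrite -fsbig_seq//= big_map big_seq [leRHS]big_seq; apply: lee_sum => P /laP[_ Px _].
by rewrite indicE mem_set// mul1r.
Qed.

End domination.

(** * Choice of constants and conclusion *)

Unset Implicit Arguments.
Theorem theorem1p1 (R : realType) (d : measure_display) (X : measurableType d)
    (rho : X -> X -> R) (mu : {measure set X -> \bar R})
    (A : finType) (D : A -> int -> set (set X)) :
  space_of_homogeneous_type rho mu ->
  (forall a : A, dyadic_cubes rho mu (D a)) ->
  adjacent_systems rho D ->
  exists eps eta : R, 0 < eps /\ 0 < eta /\
  forall F : X -> R -> R -> \bar R,
    nonneg_fun F -> monotonic_fun F -> subadditive_fun F ->
  forall c : int * set X -> R,
    (forall Q, (\bigcup_(a in [set: A]) elements (D a)) Q ->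
       0 <= c Q /\
       (mu_ext mu [set x | (c Q)%:E < nontangential_max rho Q.2 F x]
          <= eps%:E * mu Q.2)%E) ->
  exists S : A -> int -> set (int * set X),
    (forall a k0, S a k0 `<=` elements (D a) /\ sparse mu eta (S a k0)) /\
    {ae mu, forall x,
      (nontangential_max rho [set: X] F x <=
       liminf_ninfty (fun k0 : int =>
         \sum_(a : A) \esum_(Q in S a k0) (\1_(Q.2) x * c Q)%:E))%E}.
Proof.
move=> hX cD adj.
have [[x0]|noX] := pselect (exists x : X, True); last first.
  exists 1, 1; do 2!split => //; move=> F _ _ _ c _.
  exists (fun _ _ => set0); split.
    move=> a k0; split=> //; exists (fun=> set0); split=> //.
  by apply: aeW => x; exfalso; apply: noX; exists x.
move=> _.
have [n [K [K' [star [nmono [K1 K'1] vQ cv [starP starS adjP shr]]]]]] :=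
  cube_geometry x0 hX cD adj.
have [qm mB _ _] := hX; have [_ rhoC rhoid _] := qm.
have K0 : 0 < K by exact: lt_le_trans K1.
have K'0 : 0 < K' by exact: lt_le_trans K'1.
pose e := (4 * (#|A|.+1%:R) * K * K')^-1.
have e0 : 0 < e by rewrite invr_gt0 !mulr_gt0.
have e_small : 4 * (#|A|.+1%:R) * K * K' * e <= 1.
  by rewrite mulfV// gt_eqF// !mulr_gt0.
have e4 : e < 1.
  rewrite invf_lt1 ?mulr_gt0//.
  have A1 : (1 : R) <= #|A|.+1%:R by rewrite ler1n.
  have KK : 1 <= K * K' by rewrite -[leLHS]mulr1 ler_pM.
  rewrite -mulrA; apply: (@lt_le_trans _ _ (4 * 1 * 1)); first by lra.
  by apply: ler_pM => //; rewrite ?mulr_ge0// ler_pM2l.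
have vmeas Q : valid D Q -> measurable Q.2.2 by move=> /vQ[].
have vpos Q : valid D Q -> (0 < mu Q.2.2 < +oo)%E by move=> /vQ[].
(* Half of [e], since passing to a measurable hull doubles the constant. *)
exists (e / 2), 2^-1; split; first by rewrite divr_gt0.
split; first by [].
move=> F _ Fmono Fsub c Hc.
have Hc' Q : valid D Q -> 0 <= c Q.2 /\
    (mu_ext mu [set x | (c Q.2)%:E < nontangential_max rho Q.2.2 F x]
      <= (e / 2)%:E * mu Q.2.2)%E.
  by move=> v; apply: Hc; exists Q.1.
have /choice[Om OmP] (Q : A * (int * set X)) : exists H, valid D Q ->
    [/\ measurable H, [set x | ((c Q.2)%:E < nontangential_max rho Q.2.2 F x)%E] `<=` H,
     H `<=` Q.2.2 & (mu H <= e%:E * mu Q.2.2)%E].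
  have [v|nv] := pselect (valid D Q); last by exists set0.
  have [c0 lec] := Hc' _ v.
  have [||||H [mH EH HQ leH]] := measurable_hull _ _ _ _ lec.
  - exact: vmeas.
  - move=> x /=; rewrite /nontangential_max indicE; have [/set_mem//|_] := boolP (x \in _).
    by rewrite mul0e lte_fin ltNge c0.
  - by rewrite divr_gt0.
  - exact: vpos.
  by exists H => _; split=> //; move: leH; rewrite mulrC divfK.
have OmM Q : valid D Q -> measurable (Om Q) by move=> /OmP[].
have OmS Q : valid D Q -> Om Q `<=` Q.2.2 by move=> /OmP[].
have OmE Q : valid D Q -> (mu (Om Q) <= e%:E * mu Q.2.2)%E by move=> /OmP[].
have Om_proper Q : valid D Q -> ~ Q.2.2 `<=` Om Q.
  move=> v QO; have := measure_subset mu (vmeas _ v) (OmM _ v) QO.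
  apply/negP; rewrite -ltNge; apply: (le_lt_trans (OmE _ v)).
  have /andP[q0 qoo] := vpos _ v.
  by rewrite -[ltRHS]mul1e lte_pmul2r ?ge0_fin_numE// lte_fin.
have Om_max Q x : valid D Q -> ~ Om Q x ->
    (nontangential_max rho Q.2.2 F x <= (c Q.2)%:E)%E.
  move=> v nOm; rewrite leNgt; apply/negP => lt; apply: nOm.
  by have [_ EO _ _] := OmP _ v; exact: EO.
have nest a (l k : int) : l <= k -> forall Q Q', D a k Q -> D a l Q' ->
    Q `<=` Q' \/ Q `&` Q' = set0.
  by have [[_ _ H] _] := cD a; exact: H.
have starM Q : valid D Q -> measurable (star Q) by move=> /starP[].
have starE Q : valid D Q -> (mu (star Q) <= K%:E * mu Q.2.2)%E by move=> /starP[].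
have /choice[top topP] (k : int) : exists Q, valid D Q /\
    qball rho x0 (absz k).+1%:R `<=` Q.2.2.
  have [|P [vP BP _]] := adjP x0 ((absz k).+1%:R); first by rewrite ltr0Sn.
  exists P; split=> //; apply: subset_trans BP; apply: qballS.
  by rewrite ler_peMl// ler1n.
have /choice[S SP] (k : int) := stopping_family nmono vmeas vpos starM starS starE
  OmM OmS OmE K1 K'1 e0 e_small (topP k).1.
exists (fun a k => [set Q | S k (a, Q)]); split.
  move=> a k; have [_ Sv Spar _] := SP k; split.
    by move=> Q /Sv[].
  exact: (stopping_sparse nmono nest vmeas vpos starM starS starE
    OmM OmS OmE K1 K'1 e0 e_small cv Sv Spar a).
apply: aeW => x.
pose u (k : int) := (\sum_(a : A) \esum_(Q in [set Q | S k (a, Q)]) (\1_(Q.2) x * c Q)%:E)%E.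
rewrite -[X in liminf_ninfty X]/u.
(* A bound valid for all sufficiently negative [k] suffices, and the threshold may depend on [y] and
   [t]. *)
have liminfP v : (exists K0 : int, forall k, k <= K0 -> (v <= u k)%E) ->
    (v <= liminf_ninfty u)%E.
  move=> [k0 Hk]; apply: (@le_trans _ _ (ereal_inf [set u k | k in [set k : int | k <= k0]])).
    by apply: le_ereal_inf_tmp => _ [k kk <-]; exact: Hk.
  by apply: ereal_sup_ubound; exists k0.
rewrite /nontangential_max indicE mem_set// mul1e.
apply: ge_ereal_sup => _ [->|[y [s [t [s0 xy st _ ->]]]]].
  apply: liminfP; exists 0 => k _; apply: sume_ge0 => a _; apply: esum_ge0 => Q SQ.
  rewrite lee_fin mulr_ge0//; have [_ Sv _ _] := SP k.
  by have [v _] := Sv _ SQ; have [] := Hc' _ v.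
apply: liminfP.
have [A0 [A01 rhoA]] := quasi_metric_const qm.
pose B := A0 * (rho x0 y + t).
(* For such [k], [|k| + 1] exceeds [B], so the top cube contains [B(x0, B)] and with it
   [B(y, t)]. *)
exists (- (Num.trunc B)%:Z) => k kB.
have [vtop Btop] := topP k.
have [Stop Sv Spar Scov] := SP k.
have Bt : qball rho y t `<=` (top k).2.2.
  apply: subset_trans Btop => w yw; rewrite /qball /=.
  apply: (le_lt_trans (rhoA _ _ y)).
  apply: (@lt_trans _ _ B); first by rewrite /B ltr_pM2l ?(lt_le_trans _ A01)// ltrD2l.
  apply: (lt_le_trans (truncnS_gt _)); rewrite ler_nat.
  move: kB; set m := Num.trunc B; clear; lia.
have [l [ul lS leF]] := chain_domination rhoC (fun x => (rhoid x x).2 erefl) Fmono Fsub mB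
  vmeas OmM (ltW K'0) Om_proper (fun Q v => (Hc' Q v).1) Om_max adjP shr
  (fun P SP => (Sv P SP).1) Scov s0 xy Stop st Bt.
apply: (le_trans leF); apply: chain_le_sum => // P /lS[SP' _ Px].
by split.
Qed.
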